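(* Let $\mathcal M=\mathbb R\times\mathcal N$ with structure $(\phi,\xi,\eta,g^L)$ be the Sasakian lift of a Kähler manifold $(\mathcal N,J,g)$ with Kähler form $\omega=d\tau$. Let $R$ and $\bar R$ be the curvature operators of $g$ and $g^L$. For all vector fields $X,Y,Z$ on $\mathcal N$, $$\bar R_{X^LY^L}Z^L=(R_{XY}Z)^L+\Phi(Y^L,Z^L)\phi X^L-\Phi(X^L,Z^L)\phi Y^L-2\Phi(X^L,Y^L)\phi Z^L.$$
   Context: Conventions: $2\,d\theta(X,Y)=X\theta(Y)-Y\theta(X)-\theta([X,Y])$ for a 1-form $\theta$; $R_{XY}Z=\nabla_X\nabla_YZ-\nabla_Y\nabla_XZ-\nabla_{[X,Y]}Z$, where $\nabla$ is the Levi-Civita connection. On a Kähler manifold $(\mathcal N,J,g)$, $\dim\mathcal N=2n$, the Kähler form is $\omega(X,Y)=g(X,JY)$; it is assumed that there is a global 1-form $\tau$ with $\omega=d\tau$. Sasakian lift: $\mathcal M=\mathbb R\times\mathcal N$ with projection $\pi_2:\mathcal M\to\mathcal N$ and coordinate $t$ on $\mathbb R$; $\xi=\partial_t$, $\eta=dt+\pi_2^*\tau$. A vector field $X$ on $\mathcal N$ is lifted to $X^L=X-(\tau(X)\circ\pi_2)\,\xi$ on $\mathcal M$. The $(1,1)$-tensor $\phi$ and metric $g^L$ are determined by $\phi X^L=(JX)^L$, $\phi\xi=0$, $g^L=\eta\otimes\eta+\pi_2^*g$. This structure is Sasakian, with fundamental form $\Phi(\cdot,\cdot)=g^L(\cdot,\phi\,\cdot)=d\eta$.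 *)

(* Defs.v *)
From HB Require Import structures.
From mathcomp Require Import all_boot all_order all_algebra.
From mathcomp Require Import all_classical all_reals all_analysis.
Set Implicit Arguments.
Unset Strict Implicit.
Unset Printing Implicit Defensive.
Import Order.TTheory GRing.Theory Num.Theory numFieldNormedType.Exports.
Local Open Scope classical_set_scope.
Local Open Scope ring_scope.

(* The classes C^k and C^oo on an open subset of a normed space, meant for
   finite-dimensional spaces: there, asking that every directional derivative
   be C^k is the same as asking that the differential be C^k. *)
Fixpoint Ck (k : nat) (R : realType) (V W : normedModType R)
    (A : set V) (f : V -> W) : Prop :=
  match k with
  | 0%N => forall x, A x -> {for x, continuous f}
  | k'.+1 => (forall x, A x -> differentiable f x) /\
             (forall v, Ck k' A (fun x => 'd f x v))
  end.

Definition smooth_on (R : realType) (V W : normedModType R)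
    (A : set V) (f : V -> W) : Prop := forall k, Ck k A f.

Section CkTheory.
Variable R : realType.
Implicit Types V W U : normedModType R.

Lemma near_diff V W (f g : V -> W) (x : V) :
  (\forall y \near x, f y = g y) -> differentiable f x ->
  differentiable g x /\ ('d g x = 'd f x :> (V -> W)).
Proof.
move=> fg df.
have gx : g x = f x by rewrite (nbhs_singleton fg).
have fg0 : \forall h \near (0 : V), f (h + x) = g (h + x).
  have H : \forall h \near (0 : V), f (h + (x - 0)) = g (h + (x - 0)).
    by have /= <- := @near_shift _ _ 0 x (fun y => f y = g y).
  by apply: filterS H => h; rewrite subr0.
have dg : g \o shift x = cst (g x) + 'd f x +o_ (0 : V) id.
  have /eqaddoP fo := diff_locally df.
  apply/eqaddoP => e e0; near=> h.
  rewrite gx.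
  rewrite /= !fctE/=.
  have <- : f (h + x) = g (h + x) by near: h; exact: fg0.
  by near: h; exact: fo.
have E := diff_unique (diff_continuous df) dg; split=> //.
by apply/diff_locallyP; rewrite E; split=> //; exact: diff_continuous.
Unshelve. all: by end_near. Qed.

Lemma Ck_ext k V W (A : set V) (f g : V -> W) : open A ->
  (forall x, A x -> f x = g x) -> Ck k A f -> Ck k A g.
Proof.
move=> oA; elim: k V W A oA f g => [|k IH] V W A oA f g fg /=.
  move=> cf x Ax; have Anear : nbhs x A by exact: open_nbhs_nbhs.
  rewrite /prop_for /continuous_at -(fg x Ax).
  apply: cvg_trans (cf x Ax); apply: near_eq_cvg.
  by apply: filterS Anear => y Ay; rewrite fg.
move=> [df Cf]; have H x : A x ->
    differentiable g x /\ ('d g x = 'd f x :> (V -> W)).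
  move=> Ax; apply: near_diff; last exact: df.
  have Anear : nbhs x A by exact: open_nbhs_nbhs.
  by apply: filterS Anear => y; exact: fg.
split=> [x /H[]//|v]; apply: (IH _ _ _ oA (fun x => 'd f x v)) => // x Ax.
by rewrite (H x Ax).2.
Qed.

Lemma Ck_cst k V W (A : set V) (c : W) : Ck k A (fun _ : V => c).
Proof.
elim: k V W A c => [|k IH] V W A c /=; first by move=> x _; exact: cst_continuous.
split=> [x _|v]; first exact: differentiable_cst.
have -> : (fun x : V => 'd (fun _ : V => c) x v) = fun _ => 0; last exact: IH.
by apply/funext => x; rewrite diff_cst.
Qed.

Lemma open_setTX (T U : topologicalType) (B : set U) :
  open B -> open ([set: T] `*` B).
Proof.
rewrite !openE => oB [t u] [_ /= Bu]; exists (setT, B) => //=.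
by split; [exact: filterT|exact: oB].
Qed.

Lemma Ck_snd k V W U (B : set W) (f : W -> U) : open B ->
  Ck k B f -> Ck k ([set: V] `*` B) (fun z => f z.2).
Proof.
move=> oB; elim: k V W U B oB f => [|k IH] V W U B oB f /=.
  move=> cf z [_ Bz]; apply: (@continuous_comp _ _ _ snd f).
    exact: cvg_snd.
  exact: cf.
move=> [df Cf].
have ds (z : V * W) : differentiable (snd : V * W -> W) z.
  by apply: linear_differentiable => ?; exact: cvg_snd.
have Ds (z : V * W) : 'd (snd : V * W -> W) z = snd :> (V * W -> W).
  by apply: diff_lin => ?; exact: cvg_snd.
split=> [z [_ Bz]|v].
  by apply: (@differentiable_comp _ _ _ _ snd f); [exact: ds|exact: df].
apply: (@Ck_ext k (V * W)%type U _ (fun z => 'd f (z.2) v.2)).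
- exact: open_setTX.
- move=> z [_ Bz]; rewrite (@diff_comp _ _ _ _ snd f) ?Ds//.
  exact: df.
- exact: (IH _ _ _ _ oB (fun w => 'd f w v.2)).
Qed.

Lemma Ck_fst k V W (A : set (V * W)) : Ck k A (fst : V * W -> V).
Proof.
case: k => [|k] /=; first by move=> z _; exact: cvg_fst.
split=> [z _|v]; first by apply: linear_differentiable => ?; exact: cvg_fst.
have -> : (fun z => 'd (fst : V * W -> V) z v) = fun _ => v.1; last exact: Ck_cst.
by apply/funext => z; rewrite diff_lin// => ?; exact: cvg_fst.
Qed.

Lemma Ck_pair k V W U (A : set V) (f : V -> W) (g : V -> U) : open A ->
  Ck k A f -> Ck k A g -> Ck k A (fun x => (f x, g x)).
Proof.
move=> oA; elim: k V W U A oA f g => [|k IH] V W U A oA f g /=.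
  by move=> cf cg x Ax; apply: cvg_pair; [exact: cf|exact: cg].
move=> [df Cf] [dg Cg]; split=> [x Ax|v].
  by apply: differentiable_pair; [exact: df|exact: dg].
apply: (@Ck_ext _ _ _ _ (fun x => ('d f x v, 'd g x v))) => //.
  by move=> x Ax; rewrite diff_pair//; [exact: df|exact: dg].
exact: IH.
Qed.

End CkTheory.

(* Smooth manifolds without boundary modelled on E (R^m with m = \dim E).
   Each point p comes with a preferred chart around it; by means of that chart
   the tangent space at p is identified with E itself. *)
Record smooth_manifold (R : realType) (E : normedModType R) := SmoothManifold {
  mpoint :> topologicalType;
  chart : Type;
  dom : chart -> set mpoint;
  img : chart -> set E;
  coord : chart -> mpoint -> E;
  param : chart -> E -> mpoint;
  chart_at : mpoint -> chart;
  manifold_hausdorff : hausdorff_space mpoint;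
  manifold_second_countable : @second_countable mpoint;
  dom_chart_at : forall p, dom (chart_at p) p;
  dom_open : forall i, open (dom i);
  img_open : forall i, open (img i);
  coord_img : forall i p, dom i p -> img i (coord i p);
  param_dom : forall i y, img i y -> dom i (param i y);
  coordK : forall i p, dom i p -> param i (coord i p) = p;
  paramK : forall i y, img i y -> coord i (param i y) = y;
  coord_continuous : forall i p, dom i p -> {for p, continuous (coord i)};
  param_continuous : forall i y, img i y -> {for y, continuous (param i)};
  transition_smooth : forall i j,
    smooth_on (img i `&` param i @^-1` dom j) (coord j \o param i)
}.

Section Manifold.
Variables (R : realType) (E : normedModType R) (M : smooth_manifold E).

(* Differential at p of the chart i, from T_pM to E, and its inverse. *)
Definition to_chart (i : chart M) (p : M) : E -> E :=
  'd (coord i \o param (chart_at p)) (coord (chart_at p) p).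
Definition of_chart (i : chart M) (p : M) : E -> E :=
  'd (coord (chart_at p) \o param i) (coord i p).

(* X p is the tangent vector at p, read in the preferred chart at p. *)
Definition vfield := M -> E.

Definition vfield_rep (X : vfield) (i : chart M) (y : E) : E :=
  to_chart i (param i y) (X (param i y)).

Definition smooth_vfield (X : vfield) : Prop :=
  forall i, smooth_on (img i) (vfield_rep X i).

Definition smooth_fun (f : M -> R) : Prop :=
  forall i, smooth_on (img i) (f \o param i).

Definition smooth_1form (a : M -> E -> R) : Prop :=
  (forall p, scalar (a p)) /\
  forall i u, smooth_on (img i)
    (fun y => a (param i y) (of_chart i (param i y) u)).

Definition smooth_2tensor (b : M -> E -> E -> R) : Prop :=
  [/\ forall p u, scalar (b p u),
      forall p v, scalar (b p ^~ v) &
      forall i u v, smooth_on (img i)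
        (fun y => b (param i y) (of_chart i (param i y) u)
                                (of_chart i (param i y) v))].

Definition smooth_endo (A : M -> E -> E) : Prop :=
  (forall p, linear (A p)) /\
  forall i u, smooth_on (img i)
    (fun y => to_chart i (param i y)
                (A (param i y) (of_chart i (param i y) u))).

Definition app_endo (A : M -> E -> E) (X : vfield) : vfield :=
  fun p => A p (X p).

(* The derivative X(f). *)
Definition dirder (X : vfield) (f : M -> R) : M -> R :=
  fun p => 'd (f \o param (chart_at p)) (coord (chart_at p) p) (X p).

(* [X, Y] in coordinates at p: X^j d_j Y^i - Y^j d_j X^i, the sign convention
   being [X, Y](f) = X(Y(f)) - Y(X(f)). *)
Definition lie (X Y : vfield) : vfield := fun p =>
  let i := chart_at p in
  'd (vfield_rep Y i) (coord i p) (X p) - 'd (vfield_rep X i) (coord i p) (Y p).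

(* Exterior derivative of a 1-form, normalized by
   2 da(X, Y) = X(a(Y)) - Y(a(X)) - a([X, Y]). *)
Definition ext_d (a : M -> E -> R) (X Y : vfield) : M -> R := fun p =>
  2^-1 * (dirder X (fun q => a q (Y q)) p - dirder Y (fun q => a q (X q)) p
          - a p (lie X Y p)).

Definition closed_2form (w : M -> E -> E -> R) : Prop :=
  forall X Y Z, smooth_vfield X -> smooth_vfield Y -> smooth_vfield Z ->
  forall p,
    dirder X (fun q => w q (Y q) (Z q)) p
    + dirder Y (fun q => w q (Z q) (X q)) p
    + dirder Z (fun q => w q (X q) (Y q)) p
    - w p (lie X Y p) (Z p) - w p (lie Y Z p) (X p) - w p (lie Z X p) (Y p) = 0.

Definition riemannian (g : M -> E -> E -> R) : Prop :=
  [/\ smooth_2tensor g,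
      forall p u v, g p u v = g p v u &
      forall p v, v != 0 -> 0 < g p v v].

(* The values of nabla on non-smooth fields are irrelevant. *)
Record affine_connection (nabla : vfield -> vfield -> vfield) : Prop := {
  conn_smooth : forall X Y, smooth_vfield X -> smooth_vfield Y ->
    smooth_vfield (nabla X Y);
  connDl : forall X X' Y,
    smooth_vfield X -> smooth_vfield X' -> smooth_vfield Y ->
    forall p, nabla (fun q => X q + X' q) Y p = nabla X Y p + nabla X' Y p;
  connDr : forall X Y Y',
    smooth_vfield X -> smooth_vfield Y -> smooth_vfield Y' ->
    forall p, nabla X (fun q => Y q + Y' q) p = nabla X Y p + nabla X Y' p;
  connZl : forall f X Y, smooth_fun f -> smooth_vfield X -> smooth_vfield Y ->
    forall p, nabla (fun q => f q *: X q) Y p = f p *: nabla X Y p;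
  connZr : forall f X Y, smooth_fun f -> smooth_vfield X -> smooth_vfield Y ->
    forall p, nabla X (fun q => f q *: Y q) p =
      dirder X f p *: Y p + f p *: nabla X Y p
}.

Record levi_civita (g : M -> E -> E -> R) (nabla : vfield -> vfield -> vfield)
    : Prop := {
  lc_connection : affine_connection nabla;
  lc_torsion_free : forall X Y, smooth_vfield X -> smooth_vfield Y ->
    forall p, nabla X Y p - nabla Y X p = lie X Y p;
  lc_metric : forall X Y Z,
    smooth_vfield X -> smooth_vfield Y -> smooth_vfield Z ->
    forall p, dirder X (fun q => g q (Y q) (Z q)) p =
      g p (nabla X Y p) (Z p) + g p (Y p) (nabla X Z p)
}.

Definition curvature (nabla : vfield -> vfield -> vfield) (X Y Z : vfield)
    : vfield := fun p =>
  nabla X (nabla Y Z) p - nabla Y (nabla X Z) p - nabla (lie X Y) Z p.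

Definition nijenhuis (J : M -> E -> E) (X Y : vfield) : vfield := fun p =>
  lie (app_endo J X) (app_endo J Y) p - J p (lie (app_endo J X) Y p)
  - J p (lie X (app_endo J Y) p) - lie X Y p.

Definition kahler_form (J : M -> E -> E) (g : M -> E -> E -> R)
    : M -> E -> E -> R := fun p u v => g p u (J p v).

(* Integrability of the almost complex structure is expressed by the vanishing
   of the Nijenhuis tensor. *)
Record kahler (J : M -> E -> E) (g : M -> E -> E -> R) : Prop := {
  kahler_endo : smooth_endo J;
  kahler_sqr : forall p v, J p (J p v) = - v;
  kahler_integrable : forall X Y, smooth_vfield X -> smooth_vfield Y ->
    forall p, nijenhuis J X Y p = 0;
  kahler_riemannian : riemannian g;
  kahler_hermitian : forall p u v, g p (J p u) (J p v) = g p u v;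
  kahler_closed : closed_2form (kahler_form J g)
}.

End Manifold.

Section LineProduct.
Variables (R : realType) (E : normedModType R) (N : smooth_manifold E).

Lemma second_countable_real : @second_countable R.
Proof.
pose f (q : rat * rat) : set R := `]ratr q.1, ratr q.2[%classic.
exists (range f); first exact/(sub_countable (card_image_le _ _))/countableP.
split=> [_ [q _ <-]|x A Ax]; first exact: interval_open.
have /nbhs_ballP[e /= e0 eA] := Ax.
have [a /[!in_itv]/= /andP[a1 a2]] : exists a, ratr a \in `]x - e, x[.
  by apply: rat_in_itvoo; rewrite ltrBlDr ltrDl.
have [b /[!in_itv]/= /andP[b1 b2]] : exists b, ratr b \in `]x, x + e[.
  by apply: rat_in_itvoo; rewrite ltrDl.
exists (f (a, b)); first split; [by exists (a, b)| |].
  by rewrite /f /= in_itv /= a2 b1.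
move=> y; rewrite /f /= in_itv /= => /andP[ay yb]; apply: eA.
rewrite /ball /= ltr_distlC; apply/andP; split; first exact: lt_trans ay.
exact: lt_trans b2.
Qed.

Lemma open_setX' (T U : topologicalType) (A : set T) (B : set U) :
  open A -> open B -> open (A `*` B).
Proof.
rewrite !openE => oA oB [t u] [/= At Bu]; exists (A, B) => //=.
by split; [exact: oA|exact: oB].
Qed.

Lemma second_countableX (T U : topologicalType) :
  @second_countable T -> @second_countable U -> @second_countable (T * U)%type.
Proof.
move=> [B cB [oB bB]] [C cC [oC bC]].
exists ((fun BC : set T * set U => BC.1 `*` BC.2) @` (B `*` C)).
  by apply: sub_countable (card_image_le _ _) _; exact: countableX.
split=> [_ [[b c] [/= Bb Cc] <-]|[t u] D [[P Q] [/= Pt Qu] PQD]].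
  by apply: open_setX'; [exact: oB|exact: oC].
have [b [Bb bt] bP] := bB _ _ Pt; have [c [Cc cu] cQ] := bC _ _ Qu.
exists (b `*` c); first by split=> //; exists (b, c).
by move=> [t' u'] [/= /bP ? /cQ ?]; exact: PQD.
Qed.

Lemma hausdorffX (T U : topologicalType) :
  hausdorff_space T -> hausdorff_space U -> hausdorff_space (T * U)%type.
Proof.
move=> hT hU [t u] [t' u'] cl; congr pair.
- apply: hT => A B At Bt'.
  have [| |[a b] [[/= Aa _] [/= Ba _]]] := cl (A `*` setT) (B `*` setT).
  + by exists (A, setT) => //=; split=> //; exact: filterT.
  + by exists (B, setT) => //=; split=> //; exact: filterT.
  + by exists a.
- apply: hU => A B Au Bu'.
  have [| |[a b] [[/= _ Ab] [/= _ Bb]]] := cl (setT `*` A) (setT `*` B).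
  + by exists (setT, A) => //=; split=> //; exact: filterT.
  + by exists (setT, B) => //=; split=> //; exact: filterT.
  + by exists b.
Qed.

Let pt := (R * N)%type : topologicalType.
Let pcoord (i : chart N) (p : pt) : (R * E)%type := (p.1, coord i p.2).
Let pparam (i : chart N) (y : (R * E)%type) : pt := (y.1, param i y.2).

Let pcoord_continuous i (p : pt) :
  ([set: R] `*` dom i) p -> {for p, continuous (pcoord i)}.
Proof.
move=> [_ pi]; have cc : {for p, continuous (fun q : pt => coord i q.2)}.
  apply: (@continuous_comp _ _ _ snd (coord i)); first exact: cvg_snd.
  exact: coord_continuous.
have cf : {for p, continuous (fst : pt -> R)} by exact: cvg_fst.
exact: cvg_pair cf cc.
Qed.

Let pparam_continuous i y :
  ([set: R] `*` img i) y -> {for y, continuous (pparam i)}.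
Proof.
move=> [_ yi]; have cc : {for y, continuous (fun z : R * E => param i z.2)}.
  apply: (@continuous_comp _ _ _ snd (param i)); first exact: cvg_snd.
  exact: param_continuous.
have cf : {for y, continuous (fst : R * E -> R)} by exact: cvg_fst.
exact: cvg_pair cf cc.
Qed.

Lemma transition_open (i j : chart N) : open (img i `&` param i @^-1` dom j).
Proof.
rewrite openE => y [yi yj]; rewrite /interior; apply: filterI.
  by apply: open_nbhs_nbhs; split=> //; exact: img_open.
apply: (param_continuous yi); apply: open_nbhs_nbhs; split=> //.
exact: dom_open.
Qed.

Let ptransition_smooth i j :
  smooth_on (([set: R] `*` img i) `&` pparam i @^-1` ([set: R] `*` dom j))
    (pcoord j \o pparam i).
Proof.
have -> : ([set: R] `*` img i) `&` pparam i @^-1` ([set: R] `*` dom j) =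
    [set: R] `*` (img i `&` param i @^-1` dom j).
  by apply/seteqP; split=> -[t y] /= => [[[_ yi] [_ yj]]|[_ [yi yj]]].
move=> k; apply: Ck_pair; first exact/open_setTX/transition_open.
  exact: Ck_fst.
apply: (@Ck_snd _ _ _ _ _ _ (coord j \o param i)).
  exact: transition_open.
exact: transition_smooth.
Qed.

(* R x N, with the product charts; the tangent space at (t, x) is R x T_xN,
   the first component being the coefficient of d/dt. *)
Definition line_prod : smooth_manifold (R * E)%type.
Proof.
refine (@SmoothManifold R (R * E)%type pt (chart N)
  (fun i => [set: R] `*` dom i) (fun i => [set: R] `*` img i)
  pcoord pparam (fun p => chart_at p.2)
  _ _ _ _ _ _ _ _ _ pcoord_continuous pparam_continuous ptransition_smooth).
- by apply: hausdorffX; [exact: Rhausdorff|exact: manifold_hausdorff].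
- apply: second_countableX; first exact: second_countable_real.
  exact: manifold_second_countable.
- by move=> p; split=> //; exact: dom_chart_at.
- by move=> i; apply: open_setTX; exact: dom_open.
- by move=> i; apply: open_setTX; exact: img_open.
- by move=> i p [_ /= pi]; split=> //; exact: coord_img.
- by move=> i y [_ /= yi]; split=> //; exact: param_dom.
- by move=> i [t x] [_ /= xi]; rewrite /pparam/= coordK.
- by move=> i [t y] [_ /= yi]; rewrite /pcoord/= paramK.
Defined.

End LineProduct.

Section SasakianLift.
Variables (R : realType) (E : normedModType R) (N : smooth_manifold E).
Variables (J : N -> E -> E) (g : N -> E -> E -> R) (tau : N -> E -> R).
Let M := line_prod N.

Definition xi : vfield M := fun _ => (1, 0).

(* eta = dt + pi_2^* tau *)
Definition eta (p : M) (v : R * E) : R := v.1 + tau p.2 v.2.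

(* X^L = X - (tau(X) o pi_2) xi *)
Definition lift_vfield (X : vfield N) : vfield M :=
  fun p => (- tau p.2 (X p.2), X p.2).

(* The values of phi are forced by phi xi = 0 and phi X^L = (J X)^L, see
   phi_xi and phi_lift below, since v = eta(v) xi + (d pi_2 v)^L. *)
Definition phi (p : M) (v : R * E) : R * E :=
  (- tau p.2 (J p.2 v.2), J p.2 v.2).

(* g^L = eta (x) eta + pi_2^* g *)
Definition gL (p : M) (u v : R * E) : R :=
  eta p u * eta p v + g p.2 u.2 v.2.

Definition Phi (U V : vfield M) : M -> R :=
  fun p => gL p (U p) (phi p (V p)).

Lemma phi_lift (X : vfield N) : app_endo (M := M) phi (lift_vfield X) = lift_vfield (app_endo J X).
Proof. by []. Qed.

Lemma phi_xi (p : M) : linear (J p.2) -> scalar (tau p.2) ->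
  phi p (xi p) = 0.
Proof.
move=> Jl tl; have J0 : J p.2 0 = 0.
  by have := Jl (-1) 0 0; rewrite scaler0 addr0 scaleN1r addNr.
have t0 : tau p.2 0 = 0.
  by have := tl (-1) 0 0; rewrite scaler0 addr0 mulN1r addNr.
by rewrite /phi /xi /= J0 t0 oppr0.
Qed.

End SasakianLift.

(* Main.v *)
Require Import Defs.
From HB Require Import structures.
From mathcomp Require Import all_boot all_order all_algebra.
From mathcomp Require Import all_classical all_reals all_analysis.
From mathcomp Require Import ring lra.
Set Implicit Arguments.
Unset Strict Implicit.
Unset Printing Implicit Defensive.
Import Order.TTheory GRing.Theory Num.Theory numFieldNormedType.Exports.
Local Open Scope ring_scope.

(* Write h(X,Y) = g(JX,Y) = - omega(X,Y). Since 2 d tau = 2 omega, lifts satisfy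
   [X^L, Y^L] = [X,Y]^L + 2 h(X,Y) xi and [xi, X^L] = 0, and the Koszul formula
   for g^L then gives
     D_{X^L} Y^L = (nabla_X Y)^L + h(X,Y) xi,
     D_{X^L} xi = D_xi X^L = - (JX)^L
   for the connection D of g^L. Expanding the curvature of D, the coefficient of
   xi is a sum of covariant derivatives of omega, which vanishes because a
   Kaehler structure has nabla J = 0; the latter is derived from d omega = 0 and
   the vanishing of the Nijenhuis tensor by the usual linear algebra applied to
   g((nabla_X J) Y, Z).
   Equalities of fields on R x N are tested against lifts of global fields only:
   freezing t in the difference of two fields on R x N gives a smooth field on
   N, and testing the difference against the lift of this one shows that it is
   0, so no bump functions or local frames are needed. *)

(** * Calculus of smooth maps: sums, products, linear images, slices *)

Section SmoothMaps.
Variable R : realType.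
Implicit Types V W U : normedModType R.
Local Open Scope classical_set_scope.

Lemma smooth_ext V W (A : set V) (f g : V -> W) : open A ->
  (forall x, A x -> f x = g x) -> smooth_on A f -> smooth_on A g.
Proof. by move=> oA fg sf k; exact: (Ck_ext oA fg (sf k)). Qed.

Lemma smooth_cst V W (A : set V) (c : W) : smooth_on A (fun=> c).
Proof. by move=> k; exact: Ck_cst. Qed.

Lemma smooth_pair V W U (A : set V) (f : V -> W) (g : V -> U) : open A ->
  smooth_on A f -> smooth_on A g -> smooth_on A (fun x => (f x, g x)).
Proof. by move=> oA sf sg k; exact: Ck_pair. Qed.

Lemma smooth_snd V W U (B : set W) (f : W -> U) : open B ->
  smooth_on B f -> smooth_on ([set: V] `*` B) (fun z => f z.2).
Proof. by move=> oB sf k; exact: Ck_snd. Qed.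

Lemma smooth_differentiable V W (A : set V) (f : V -> W) x :
  smooth_on A f -> A x -> differentiable f x.
Proof. by move=> sf; exact: (sf 1%N).1. Qed.

Lemma smooth_diff V W (A : set V) (f : V -> W) v :
  smooth_on A f -> smooth_on A (fun x => 'd f x v).
Proof. by move=> sf k; exact: (sf k.+1).2. Qed.

Lemma diffD_fun V W (f g : V -> W) x v :
  differentiable f x -> differentiable g x ->
  'd (fun y => f y + g y) x v = 'd f x v + 'd g x v.
Proof. by move=> df dg; rewrite (_ : (fun y => _) = f + g)// diffD. Qed.

Lemma CkD k V W (A : set V) (f g : V -> W) : open A ->
  Ck k A f -> Ck k A g -> Ck k A (fun x => f x + g x).
Proof.
move=> oA; elim: k f g => [|k IH] f g /=.
  by move=> cf cg x Ax; apply: cvgD; [exact: cf|exact: cg].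
move=> [df Cf] [dg Cg]; split=> [x Ax|v].
  by apply: differentiableD; [exact: df|exact: dg].
apply: (@Ck_ext _ _ _ _ _ (fun x => 'd f x v + 'd g x v)) => //.
  by move=> x Ax; rewrite diffD_fun//; [exact: df|exact: dg].
exact: IH.
Qed.

Lemma smoothD V W (A : set V) (f g : V -> W) : open A ->
  smooth_on A f -> smooth_on A g -> smooth_on A (fun x => f x + g x).
Proof. by move=> oA sf sg k; exact: CkD. Qed.

Lemma smooth_sum V W (A : set V) (I : finType) (f : I -> V -> W) : open A ->
  (forall i, smooth_on A (f i)) -> smooth_on A (fun x => \sum_i f i x).
Proof.
move=> oA sf; elim: (index_enum I) => [|i s IH].
  apply: (@smooth_ext _ _ _ (fun=> 0)) => //; last exact: smooth_cst.
  by move=> x _; rewrite big_nil.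
apply: (@smooth_ext _ _ _ (fun x => f i x + \sum_(j <- s) f j x)) => //.
  by move=> x _; rewrite big_cons.
exact: smoothD.
Qed.

Lemma scale_is_bilinear V :
  bilinear_for
    (GRing.Scale.Law.clone _ _ *:%R _) (GRing.Scale.Law.clone _ _ *:%R _)
    (@GRing.scale R V).
Proof.
split=> [v|a] b x y /=; first by rewrite scalerDl scalerA.
by rewrite scalerDr !scalerA mulrC.
Qed.
HB.instance Definition _ V := bilinear_isBilinear.Build R R V V _ _
  (@GRing.scale R V) (@scale_is_bilinear V).

Section Scale.
Variables (V W : normedModType R) (f : V -> R) (F : V -> W) (x : V).
Hypotheses (df : differentiable f x) (dF : differentiable F x).

Let sc : continuous (fun p : R * W => p.1 *: p.2).
Proof. exact: scale_continuous. Qed.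

Let ds : differentiable (fun p : R * W => p.1 *: p.2) (f x, F x).
Proof. exact: (@differentiable_bilin _ _ _ _ (@GRing.scale R W)). Qed.

Let dp : differentiable (fun y => (f y, F y)) x.
Proof. exact: differentiable_pair. Qed.

Lemma differentiable_scale : differentiable (fun y => f y *: F y) x.
Proof.
exact: (@differentiable_comp _ _ _ _ (fun y => (f y, F y))
         (fun p : R * W => p.1 *: p.2)).
Qed.

Lemma diff_scale v :
  'd (fun y => f y *: F y) x v = f x *: 'd F x v + 'd f x v *: F x.
Proof.
have -> : (fun y => f y *: F y) =
  (fun p : R * W => p.1 *: p.2) \o (fun y => (f y, F y)) by [].
by rewrite diff_comp//= (@diff_bilin _ _ _ _ (@GRing.scale R W))//= diff_pair.
Qed.

End Scale.

(** The induction on [k] keeps full smoothness of both factors as hypothesis: the product rule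
    leaves [f] and [F] undifferentiated in one term each, so [Ck k.+1] would first have to be
    lowered to [Ck k]. *)
Lemma smoothZ V W (A : set V) (f : V -> R) (F : V -> W) : open A ->
  smooth_on A f -> smooth_on A F -> smooth_on A (fun x => f x *: F x).
Proof.
move=> oA sf sF k; elim: k f F sf sF => [|k IH] f F sf sF /=.
  move=> x Ax; apply: differentiable_continuous.
  by apply: differentiable_scale; exact: smooth_differentiable Ax.
split=> [x Ax|v].
  by apply: differentiable_scale; exact: smooth_differentiable Ax.
apply: (@Ck_ext _ _ _ _ _ (fun x => f x *: 'd F x v + 'd f x v *: F x)) => //.
  by move=> x Ax; rewrite diff_scale//; exact: smooth_differentiable Ax.
by apply: CkD => //; apply: IH => //; exact: smooth_diff.
Qed.

Lemma smooth_linear V W U (A : set V) (L : {linear W -> U}) (f : V -> W) :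
  open A -> continuous L -> smooth_on A f -> smooth_on A (fun x => L (f x)).
Proof.
move=> oA cL sf k; elim: k f sf => [|k IH] f sf /=.
  by move=> x Ax; apply: continuous_comp; [exact: (sf 0%N)|exact: cL].
have dL y : differentiable L y by exact: linear_differentiable.
have df x : A x -> differentiable f x by exact: smooth_differentiable.
split=> [x Ax|v].
  by apply: (@differentiable_comp _ _ _ _ f L); [exact: df|exact: dL].
apply: (@Ck_ext _ _ _ _ _ (fun x => L ('d f x v))) => //.
  by move=> x Ax; rewrite (@diff_comp _ _ _ _ f L)// ?diff_lin//; exact: df.
exact: (IH (fun x => 'd f x v) (smooth_diff v sf)).
Qed.

(** The inclusion of the slice has differential [v |-> (0, v)], so a directional derivative of the
    slice is again a slice, of the derivative of [F] along [(0, v)]; hence the induction. *)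
Lemma smooth_slice V W U (B : set W) (F : V * W -> U) (a : V) : open B ->
  smooth_on ([set: V] `*` B) F -> smooth_on B (fun y => F (a, y)).
Proof.
move=> oB sF k; elim: k F sF => [|k IH] F sF /=.
  move=> y By; apply: (@continuous_comp _ _ _ (fun y => (a, y)) F).
    by apply: cvg_pair; [exact: cvg_cst|exact: cvg_id].
  exact: (sF 0%N).
have di (y : W) : differentiable (fun y : W => (a, y)) y.
  exact: differentiable_pair.
have dF y : B y -> differentiable F (a, y).
  by move=> By; exact: smooth_differentiable sF _.
split=> [y By|v].
  by apply: (@differentiable_comp _ _ _ _ (fun y => (a, y)) F); last exact: dF.
apply: (@Ck_ext _ _ _ _ _ (fun y => 'd F (a, y) (0, v))) => //.
  move=> y By.
  rewrite (@diff_comp _ _ _ _ (fun y => (a, y)) F)//; last exact: dF.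
  by rewrite /= diff_pair// diff_cst/= diff_val.
exact: (IH (fun z => 'd F z (0, v)) (smooth_diff (0, v) sF)).
Qed.

Lemma smooth_coord V m n (A : set V) (f : V -> 'M[R]_(m, n)) i j :
  open A -> smooth_on A f -> smooth_on A (fun x => f x i j).
Proof.
move=> oA sf.
pose c (N : 'M[R]_(m, n)) : R := N i j.
have lc : linear c by move=> a M M'; rewrite /c !mxE.
pose cM := GRing.isLinear.Build _ _ _ _ _ lc.
pose cL : {linear _ -> _} := HB.pack c cM.
exact: (@smooth_linear _ _ _ _ cL _ oA (@coord_continuous _ _ _ i j)).
Qed.

End SmoothMaps.

Local Notation coord := Defs.coord.

(** * Chart changes, and the algebra of smooth fields and functions *)

Section Manifolds.
Variables (R : realType) (E : normedModType R) (M : smooth_manifold E).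
Implicit Types X Y : vfield M.

Lemma transition_differentiable (i j : chart M) p : dom i p -> dom j p ->
  differentiable (coord j \o param i) (coord i p).
Proof.
move=> pi pj; apply: (smooth_differentiable (@transition_smooth _ _ M i j)).
by split; [exact: coord_img|rewrite /= coordK].
Qed.

(** Chain rule for the two mutually inverse transition maps between [i] and the preferred chart at
    [p]. *)
Lemma to_chartK (i : chart M) p v : dom i p ->
  of_chart i p (to_chart i p v) = v.
Proof.
move=> pi; rewrite /of_chart /to_chart; set c := chart_at p.
have pc : dom c p by exact: dom_chart_at.
have cci : coord i p = (coord i \o param c) (coord c p) by rewrite /= coordK.
have dic := transition_differentiable pi pc.
have dci := transition_differentiable pc pi.
rewrite cci in dic *.
(* The composite is the identity only on the overlap of the charts, which is open; equality near the
   point suffices to compare differentials. *)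
have near_id : \forall y \near coord c p,
    id y = ((coord c \o param i) \o (coord i \o param c)) y.
  have : nbhs (coord c p) (img c `&` param c @^-1` dom i)%classic.
    apply: open_nbhs_nbhs; split; first exact: transition_open.
    by split; [exact: coord_img|rewrite /= coordK].
  by apply: filterS => y [yc yi]; rewrite /= coordK// paramK.
have did : differentiable id (coord c p) by [].
have [_] := near_diff near_id did.
rewrite (@diff_comp _ _ _ _ (coord i \o param c) (coord c \o param i))//.
have didE : 'd id (coord c p) v = v by rewrite diff_val.
by move=> dE; rewrite -[RHS]didE -dE.
Qed.

Lemma smooth_vfieldD X Y : smooth_vfield X -> smooth_vfield Y ->
  smooth_vfield (fun p => X p + Y p).
Proof.
move=> sX sY i; have oi := @img_open _ _ M i.
apply: (smooth_ext oi _ (smoothD oi (sX i) (sY i))) => y _.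
by rewrite /vfield_rep /to_chart linearD.
Qed.

Lemma smooth_vfieldZ f X : smooth_fun f -> smooth_vfield X ->
  smooth_vfield (fun p => f p *: X p).
Proof.
move=> sf sX i; have oi := @img_open _ _ M i.
apply: (smooth_ext oi _ (smoothZ oi (sf i) (sX i))) => y _.
by rewrite /vfield_rep /to_chart linearZ.
Qed.

Lemma smooth_fun_cst (c : R) : smooth_fun (fun _ : M => c).
Proof. by move=> i; exact: smooth_cst. Qed.

Lemma smooth_vfield0 : smooth_vfield (fun _ : M => 0).
Proof.
move=> i; apply: (smooth_ext (@img_open _ _ M i) _
  (@smooth_cst _ _ _ _ 0)) => y _.
by rewrite /vfield_rep /to_chart linear0.
Qed.

Lemma smooth_vfieldN X : smooth_vfield X -> smooth_vfield (fun p => - X p).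
Proof.
move=> sX; rewrite (_ : (fun p => _) = fun p => (cst (- 1) : M -> R) p *: X p).
  by apply: smooth_vfieldZ => //; exact: smooth_fun_cst.
by apply/funext => p; rewrite scaleN1r.
Qed.

Lemma smooth_funM (f h : M -> R) : smooth_fun f -> smooth_fun h ->
  smooth_fun (fun p => f p * h p).
Proof.
by move=> sf sh i; exact: (smoothZ (@img_open _ _ M i) (sf i) (sh i)).
Qed.

Lemma smooth_funN (f : M -> R) : smooth_fun f -> smooth_fun (fun p => - f p).
Proof.
move=> sf; rewrite (_ : (fun p => _) = fun p => cst (- 1) p * f p).
  by apply: smooth_funM => //; exact: smooth_fun_cst.
by apply/funext => p; rewrite mulN1r.
Qed.

Lemma dirder_cst X (c : R) p : dirder X (fun=> c) p = 0.
Proof.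
rewrite /dirder (_ : _ \o _ = cst c); first by rewrite diff_cst.
by [].
Qed.

Lemma dirder0 (f : M -> R) p : dirder (fun=> 0) f p = 0.
Proof. by rewrite /dirder linear0. Qed.

Lemma dirderN X f p : smooth_fun f ->
  dirder X (fun q => - f q) p = - dirder X f p.
Proof.
move=> sf; rewrite /dirder.
have df := smooth_differentiable (sf _) (coord_img (dom_chart_at p)).
rewrite (_ : _ \o _ = - (f \o param (chart_at p)))//.
by rewrite (diffN df).
Qed.

Lemma lie0 X p : lie (fun=> 0) X p = 0.
Proof.
rewrite /lie linear0 sub0r.
rewrite (_ : vfield_rep _ _ = cst 0); first by rewrite diff_cst oppr0.
by apply/funext => y; rewrite /vfield_rep /to_chart linear0.
Qed.

End Manifolds.

(** * Smoothness of tensors applied to smooth fields *)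

Section Contractions.
Variables (R : realType) (m : nat) (M : smooth_manifold 'rV[R]_m).
Implicit Types X Y : vfield M.

Let e (j : 'I_m) : 'rV[R]_m := delta_mx 0 j.

Lemma linear_sumZ (V W : lmodType R) (f : V -> W) (I : finType)
    (c : I -> R) (v : I -> V) : linear f ->
  f (\sum_i c i *: v i) = \sum_i c i *: f (v i).
Proof.
move=> lf; pose fM := GRing.isLinear.Build _ _ _ _ _ lf.
pose fL : {linear V -> W} := HB.pack f fM.
rewrite -[f]/(fL : V -> W) linear_sum; apply: eq_bigr => i _.
by rewrite linearZ.
Qed.

(** Expansion in the coordinate frame of the chart [i]. Smoothness of a tensor is defined by its
    values on this frame, so contractions with a field become finite sums of products of smooth
    functions. *)
Lemma vfield_param_sum X i y : img i y -> X (param i y) =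
  \sum_j vfield_rep X i y 0 j *: of_chart i (param i y) (e j).
Proof.
move=> yi; rewrite -[LHS](to_chartK _ (param_dom yi)).
rewrite [to_chart _ _ _]row_sum_delta /of_chart.
by apply: (linear_sumZ (f := 'd _ _)) => a u v; rewrite linearP.
Qed.

Lemma smooth_1form_app a X : smooth_1form a -> smooth_vfield X ->
  smooth_fun (fun q => a q (X q)).
Proof.
move=> [la sa] sX i; have oi := @img_open _ _ M i.
apply: (@smooth_ext _ _ _ _ (fun y => \sum_j vfield_rep X i y 0 j *:
    a (param i y) (of_chart i (param i y) (e j)))) => //.
  move=> y yi; rewrite /= (vfield_param_sum _ yi).
  by rewrite (linear_sumZ (W := R^o) _ _ (la _)).
apply: smooth_sum => // j; apply: smoothZ => //; exact: smooth_coord.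
Qed.

Lemma smooth_endo_app A X : smooth_endo A -> smooth_vfield X ->
  smooth_vfield (app_endo A X).
Proof.
move=> [lA sA] sX i; have oi := @img_open _ _ M i.
apply: (@smooth_ext _ _ _ _ (fun y => \sum_j vfield_rep X i y 0 j *:
    to_chart i (param i y)
      (A (param i y) (of_chart i (param i y) (e j))))) => //.
  move=> y yi; rewrite [RHS]/vfield_rep /app_endo (vfield_param_sum X yi).
  rewrite (linear_sumZ _ _ (lA _)) /to_chart (linear_sumZ (f := 'd _ _))//.
  by move=> a u v; rewrite linearP.
apply: smooth_sum => // j; apply: smoothZ => //; exact: smooth_coord.
Qed.

Lemma smooth_2tensor_app b X Y : smooth_2tensor b -> smooth_vfield X ->
  smooth_vfield Y -> smooth_fun (fun q => b q (X q) (Y q)).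
Proof.
move=> [lb lb' sb] sX sY i; have oi := @img_open _ _ M i.
apply: (@smooth_ext _ _ _ _ (fun y => \sum_j vfield_rep X i y 0 j *:
    \sum_k vfield_rep Y i y 0 k *: b (param i y)
      (of_chart i (param i y) (e j)) (of_chart i (param i y) (e k)))) => //.
  move=> y yi; rewrite /= (vfield_param_sum X yi).
  rewrite (linear_sumZ (W := R^o) (f := b _ ^~ _) _ _ (lb' _ _)).
  apply: eq_bigr => j _; rewrite (vfield_param_sum Y yi).
  by rewrite (linear_sumZ (W := R^o) _ _ (lb _ _)).
apply: smooth_sum => // j; apply: smoothZ => //; first exact: smooth_coord.
apply: smooth_sum => // k; apply: smoothZ => //; exact: smooth_coord.
Qed.

End Contractions.

(** * Fields on the product with a line that do not depend on t *)

Section LineProductFields.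
Variables (R : realType) (E : normedModType R) (N : smooth_manifold E).
Let M := line_prod N.
Implicit Types (X Y : vfield N) (f h : N -> R).

(** The t-independent field $f\partial_t+X$. Lifts are the case $f=-\tau(X)$, and $\xi$ is the case
    $f=1$, $X=0$. *)
Definition prod_vfield f X : vfield M := fun p => (f p.2, X p.2).

Lemma diff_snd_comp (V W U : normedModType R) (F : W -> U) (z v : V * W) :
  differentiable F z.2 -> 'd (fun y => F y.2) z v = 'd F (z.2) v.2.
Proof.
move=> dF; have cs : continuous (snd : V * W -> W) by move=> ?; exact: cvg_snd.
have ds : differentiable (snd : V * W -> W) z by exact: linear_differentiable.
by rewrite (@diff_comp _ _ _ _ snd F)//= diff_lin.
Qed.

Lemma differentiable_snd_comp (V W U : normedModType R) (F : W -> U)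
  (z : V * W) : differentiable F z.2 -> differentiable (fun y => F y.2) z.
Proof.
move=> dF; apply: (@differentiable_comp _ _ _ _ snd F) => //.
by apply: linear_differentiable => ?; exact: cvg_snd.
Qed.

Lemma to_chart_line_prod (i : chart N) (p : M) v : dom i p.2 ->
  to_chart (M := M) i p v = (v.1, to_chart i p.2 v.2).
Proof.
move=> pi; rewrite /to_chart.
set z := coord _ p; pose F := coord i \o param (chart_at p.2).
have dF : differentiable F z.2.
  by apply: transition_differentiable => //; exact: dom_chart_at.
have cf : continuous (fst : R * E -> R) by move=> ?; exact: cvg_fst.
have df : differentiable (fst : R * E -> R) z by exact: linear_differentiable.
rewrite (_ : _ \o _ = fun y : R * E => (y.1, F y.2))//.
rewrite diff_pair//; last exact: differentiable_snd_comp.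
by rewrite diff_lin// diff_snd_comp.
Qed.

Lemma vfield_rep_line_prod (W : vfield M) (i : chart N) (y : R * E) :
  img i y.2 -> vfield_rep W i y =
    ((W (y.1, param i y.2)).1,
     to_chart i (param i y.2) (W (y.1, param i y.2)).2).
Proof. by move=> yi; rewrite [LHS]to_chart_line_prod//; exact: param_dom. Qed.

Lemma smooth_prod_vfield f X : smooth_fun f -> smooth_vfield X ->
  smooth_vfield (prod_vfield f X).
Proof.
move=> sf sX; suff : forall i : chart N,
  smooth_on (img (s := M) i) (vfield_rep (prod_vfield f X) i) by [].
move=> i; have oi := @img_open _ _ N i.
have oM : open (img (s := M) i) by exact: img_open.
apply: (smooth_ext
  (f := fun y => ((f \o param i) y.2, vfield_rep X i y.2))) => //.
  by move=> y [_ yi]; rewrite vfield_rep_line_prod.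
by apply: smooth_pair => //; exact: smooth_snd.
Qed.

Lemma smooth_fun_line_prod f : smooth_fun f -> smooth_fun (fun p : M => f p.2).
Proof.
move=> sf; exact: (fun i : chart N =>
  @smooth_snd R R E R _ (f \o param i) (@img_open _ _ N i) (sf i)). Qed.

Lemma smooth_vfield_slice (W : vfield M) (t : R) : smooth_vfield W ->
  smooth_vfield (fun q : N => (W (t, q)).2).
Proof.
move=> sW i; have oi := @img_open _ _ N i.
have cs : continuous (snd : R * E -> E) by move=> ?; exact: cvg_snd.
apply: (smooth_ext oi _
  (smooth_linear (L := snd) oi cs (smooth_slice t oi (sW i)))) => y yi.
by rewrite vfield_rep_line_prod.
Qed.

Lemma dirder_line_prod f X h (p : M) : smooth_fun h ->
  dirder (prod_vfield f X) (fun q : M => h q.2) p = dirder X h p.2.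
Proof.
move=> sh; rewrite /dirder.
rewrite (@diff_snd_comp _ _ _ (h \o param (chart_at p.2)))//.
exact: (smooth_differentiable (sh _) (coord_img (dom_chart_at p.2))).
Qed.

Lemma diff_rep_prod_vfield f X (p : M) (v : R * E) :
  smooth_fun f -> smooth_vfield X ->
  let z := coord (chart_at p.2) p.2 in
  'd (vfield_rep (prod_vfield f X) (chart_at p)) (coord (chart_at p) p) v =
    ('d (f \o param (chart_at p.2)) z v.2,
     'd (vfield_rep X (chart_at p.2)) z v.2).
Proof.
move=> sf sX z; set c : chart N := chart_at p.2.
have zc : img c z by exact: coord_img (dom_chart_at _).
have dX : differentiable (vfield_rep X c) z.
  exact: smooth_differentiable (sX c) zc.
have df : differentiable (f \o param c) z.
  exact: smooth_differentiable (sf c) zc.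
pose F (y : R * E) := ((f \o param c) y.2, vfield_rep X c y.2).
have dF : differentiable F (p.1, z).
  by apply: differentiable_pair; exact: differentiable_snd_comp.
(* The product form of the representative holds over the image of the chart, a neighbourhood of the
   point. *)
have FE : \forall y \near ((p.1, z) : R * E),
    F y = vfield_rep (prod_vfield f X) c y.
  have : nbhs ((p.1, z) : R * E) (img (s := M) c).
    by apply: open_nbhs_nbhs; split; first exact: img_open.
  by apply: filterS => y [_ yi]; rewrite vfield_rep_line_prod.
have [_ ->] := near_diff FE dF.
rewrite diff_pair//; try exact: differentiable_snd_comp.
by rewrite (diff_snd_comp (F := f \o param c))// diff_snd_comp.
Qed.

(** Nothing depends on t, so the $\partial_t$ components differentiate nothing: the bracket is
    $(Xh-Yf)\partial_t+[X,Y]$. *)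
Lemma lie_prod_vfield f X h Y (p : M) : smooth_fun f -> smooth_vfield X ->
  smooth_fun h -> smooth_vfield Y ->
  lie (prod_vfield f X) (prod_vfield h Y) p =
    (dirder X h p.2 - dirder Y f p.2, lie X Y p.2).
Proof.
move=> sf sX sh sY.
have dY := diff_rep_prod_vfield p (prod_vfield f X p) sh sY.
have dX := diff_rep_prod_vfield p (prod_vfield h Y p) sf sX.
by refine (eq_trans (f_equal2 (fun u v : R * E => u - v) dY dX) _).
Qed.

End LineProductFields.

(** * Symmetric forms, their Levi-Civita connections and the Koszul formula *)

Section LeviCivita.
Variables (R : realType) (E : normedModType R) (M : smooth_manifold E).
Variables (g : M -> E -> E -> R) (nabla : vfield M -> vfield M -> vfield M).
Hypotheses (g_linear : forall p u, scalar (g p u))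
  (g_sym : forall p u v, g p u v = g p v u) (lc : levi_civita g nabla).
Implicit Types X Y Z W : vfield M.

Lemma form_linear p u a v w : g p u (a *: v + w) = a * g p u v + g p u w.
Proof. exact: g_linear. Qed.

Lemma formDr p u v w : g p u (v + w) = g p u v + g p u w.
Proof. by have := form_linear p u 1 v w; rewrite scale1r mul1r. Qed.

Lemma form0r p u : g p u 0 = 0.
Proof. by have := formDr p u 0 0; rewrite addr0; lra. Qed.

Lemma formZr p u a v : g p u (a *: v) = a * g p u v.
Proof. by have := form_linear p u a v 0; rewrite !addr0 form0r addr0. Qed.

Lemma formNr p u v : g p u (- v) = - g p u v.
Proof. by rewrite -scaleN1r formZr mulN1r. Qed.

Lemma formDl p u v w : g p (u + v) w = g p u w + g p v w.
Proof. by rewrite g_sym formDr !(g_sym p w). Qed.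

Lemma formNl p u v : g p (- u) v = - g p u v.
Proof. by rewrite g_sym formNr g_sym. Qed.

Lemma connN X Y : smooth_vfield X -> smooth_vfield Y ->
  forall p, nabla X (fun q => - Y q) p = - nabla X Y p.
Proof.
move=> sX sY p; rewrite (_ : (fun q => - Y q) =
  fun q => (cst (-1) : M -> R) q *: Y q).
  have -> := connZr (lc_connection lc) (smooth_fun_cst (M := M) (- 1)) sX sY p.
  by rewrite dirder_cst scale0r add0r scaleN1r.
by apply/funext => q; rewrite scaleN1r.
Qed.

Lemma connNl X Y : smooth_vfield X -> smooth_vfield Y ->
  forall p, nabla (fun q => - X q) Y p = - nabla X Y p.
Proof.
move=> sX sY p; rewrite (_ : (fun q => - X q) =
  fun q => (cst (-1) : M -> R) q *: X q).
  have -> := connZl (lc_connection lc) (smooth_fun_cst (M := M) (- 1)) sX sY p.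
  by rewrite scaleN1r.
by apply/funext => q; rewrite scaleN1r.
Qed.

(** Torsion-freeness makes the bracket a difference of covariant derivatives, which are smooth by
    the definition of a connection; no computation in charts is needed. *)
Lemma smooth_lie X Y : smooth_vfield X -> smooth_vfield Y ->
  smooth_vfield (lie X Y).
Proof.
move=> sX sY.
rewrite (_ : lie X Y = fun p => nabla X Y p + (- nabla Y X p)).
  apply: smooth_vfieldD; first exact: (conn_smooth (lc_connection lc)).
  by apply: smooth_vfieldN; exact: (conn_smooth (lc_connection lc)).
by apply/funext => p; rewrite -(lc_torsion_free lc).
Qed.

(** Expanding the derivatives by metricity and the brackets by torsion-freeness, all other terms
    cancel. It serves both for $g$ and for $g^L$. *)
Lemma koszul X Y Z : smooth_vfield X -> smooth_vfield Y -> smooth_vfield Z ->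
  forall p, 2 * g p (nabla X Y p) (Z p) =
    dirder X (fun q => g q (Y q) (Z q)) p
    + dirder Y (fun q => g q (X q) (Z q)) p
    - dirder Z (fun q => g q (X q) (Y q)) p
    + g p (lie X Y p) (Z p) - g p (lie X Z p) (Y p) - g p (lie Y Z p) (X p).
Proof.
move=> sX sY sZ p; rewrite !(lc_metric lc)//.
rewrite -!(lc_torsion_free lc)// !formDl !formNl.
rewrite (g_sym p (Y p) (nabla X Z p)) (g_sym p (X p) (nabla Y Z p)).
by rewrite (g_sym p (X p) (nabla Z Y p)); lra.
Qed.

End LeviCivita.

(** * A Kähler structure satisfies $\nabla J=0$ *)

Section KahlerParallel.
Variables (R : realType) (m : nat) (N : smooth_manifold 'rV[R]_m).
Variables (J : N -> 'rV[R]_m -> 'rV[R]_m).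
Variables (g : N -> 'rV[R]_m -> 'rV[R]_m -> R).
Variable nabla : vfield N -> vfield N -> vfield N.
Hypotheses (K : kahler J g) (lc : levi_civita g nabla).
Implicit Types X Y Z : vfield N.
Let JJ := app_endo J.

Lemma kahler_linear p u : scalar (g p u).
Proof. by case: (kahler_riemannian K) => -[]. Qed.

Lemma kahler_sym p u v : g p u v = g p v u.
Proof. by case: (kahler_riemannian K). Qed.

Let gl := kahler_linear.
Let gs := kahler_sym.
Let gDr := formDr gl.
Let gDl := formDl gl gs.
Let gNr := formNr gl.
Let gNl := formNl gl gs.

Lemma kahler_J_additive p u v : J p (u + v) = J p u + J p v.
Proof. by have := (kahler_endo K).1 p 1 u v; rewrite !scale1r. Qed.

Lemma kahler_JN p u : J p (- u) = - J p u.
Proof.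
have J0 : J p 0 = 0.
  by apply: (addrI (J p 0)); rewrite addr0 -kahler_J_additive addr0.
by apply/eqP; rewrite -addr_eq0 -kahler_J_additive addNr J0.
Qed.

Lemma kahler_skew p u v : g p (J p u) v = - g p u (J p v).
Proof. by rewrite -(kahler_hermitian K) (kahler_sqr K) gNl. Qed.

Lemma smooth_J X : smooth_vfield X -> smooth_vfield (JJ X).
Proof. exact: smooth_endo_app (kahler_endo K). Qed.

Let sD X Y : smooth_vfield X -> smooth_vfield Y -> smooth_vfield (nabla X Y).
Proof. exact: (conn_smooth (lc_connection lc)). Qed.

(** This is $(\nabla_XJ)Y$. *)
Let B X Y : vfield N := fun p => nabla X (JJ Y) p - J p (nabla X Y p).

Let smooth_B X Y : smooth_vfield X -> smooth_vfield Y -> smooth_vfield (B X Y).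
Proof.
move=> sX sY; apply: smooth_vfieldD; first by apply: sD => //; exact: smooth_J.
by apply: smooth_vfieldN; apply: (smooth_J (sD sX sY)).
Qed.

Let JJE X : JJ (JJ X) = fun p => - X p.
Proof. by apply/funext => p; exact: (kahler_sqr K). Qed.

(** Differentiating $J^2=-1$ shows that $\nabla_XJ$ anticommutes with $J$. *)
Let B_J X Y p : smooth_vfield X -> smooth_vfield Y ->
  B X (JJ Y) p = - J p (B X Y p).
Proof.
move=> sX sY; rewrite /B JJE (connN lc)// kahler_J_additive kahler_JN.
by rewrite (kahler_sqr K) opprD !opprK addrC.
Qed.

Let B_N X Y p : smooth_vfield X -> smooth_vfield Y ->
  B X (fun q => - Y q) p = - B X Y p.
Proof.
move=> sX sY; rewrite /B (_ : JJ _ = fun q => - JJ Y q).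
  rewrite !(connN lc)//; last exact: smooth_J.
  by rewrite kahler_JN opprB opprK addrC.
by apply/funext => q; exact: kahler_JN.
Qed.

Let B_Nl X Y p : smooth_vfield X -> smooth_vfield Y ->
  B (fun q => - X q) Y p = - B X Y p.
Proof.
move=> sX sY; rewrite /B !(connNl lc)//; last exact: smooth_J.
by rewrite kahler_JN opprB opprK addrC.
Qed.

(** Equivalently $(\nabla_X\omega)(Z,Y)$. *)
Let A X Y Z p := g p (B X Y p) (Z p).

Let conn_J X Y p : nabla X (JJ Y) p = B X Y p + J p (nabla X Y p).
Proof. by rewrite /B subrK. Qed.

Let A_J X Y Z p : smooth_vfield X -> smooth_vfield Y ->
  A X (JJ Y) Z p = A X Y (JJ Z) p.
Proof. by move=> sX sY; rewrite /A B_J// gNl kahler_skew opprK. Qed.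

(** The covariant derivative of the skew endomorphism $J$ is skew. The intermediate claim [H] comes
    from differentiating $g(JY,JZ)=g(Y,Z)$; applying it to $JZ$ and moving $J$ across with [A_J]
    removes every $J$. *)
Let A_skew X Y Z p : smooth_vfield X -> smooth_vfield Y -> smooth_vfield Z ->
  A X Y Z p = - A X Z Y p.
Proof.
move=> sX sY; suff H : forall Z, smooth_vfield Z ->
    A X Y (JJ Z) p + A X Z (JJ Y) p = 0.
  move=> sZ; have sJ := smooth_J sZ.
  have := H _ sJ; rewrite -[A X (JJ Z) _ _]A_J// JJE /A B_N// gNl gNr.
  by lra.
move=> {}Z sZ; have sJY := smooth_J sY; have sJZ := smooth_J sZ.
have := lc_metric lc sX sJY sJZ p; rewrite !conn_J.
rewrite (_ : (fun q => _) = fun q => g q (Y q) (Z q)); last first.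
  by apply/funext => q; exact: (kahler_hermitian K).
rewrite (lc_metric lc sX sY sZ) gDl gDr !(kahler_hermitian K).
by rewrite /A (gs p (B X Z p)) => h; move: h; rewrite /JJ /app_endo; lra.
Qed.

(** For a torsion-free connection $d\omega$ is, up to a factor, the cyclic sum of $\nabla\omega$;
    this is $d\omega=0$. *)
Let A_cycle X Y Z p : smooth_vfield X -> smooth_vfield Y -> smooth_vfield Z ->
  A X Y Z p + A Y Z X p + A Z X Y p = 0.
Proof.
move=> sX sY sZ.
(* Leibniz rule for $U(\omega(V,W))$, with the error term coming from $\nabla J$; the remaining
   connection terms cancel against the brackets. *)
have D U V W : smooth_vfield U -> smooth_vfield V -> smooth_vfield W ->
    dirder U (fun q => g q (V q) (JJ W q)) p =
    g p (nabla U V p) (J p (W p)) - A U V W p - g p (nabla U W p) (J p (V p)).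
  move=> sU sV sW; rewrite (lc_metric lc sU sV (smooth_J sW)) conn_J gDr.
  rewrite -(opprK (g p (V p) (J p _))) -kahler_skew (gs p (J p _)).
  rewrite (gs p (V p) (B _ _ _)) -/(A U W V p) A_skew//.
  by rewrite -[JJ W p]/(J p (W p)); lra.
have := kahler_closed K sX sY sZ p; rewrite /kahler_form.
rewrite -/(app_endo J) -/JJ !D// -!(lc_torsion_free lc)// !gDl !gNl.
lra.
Qed.

(** Torsion-freeness turns the brackets of the Nijenhuis tensor into covariant derivatives, which
    regroup into four values of $\nabla J$. *)
Let A_nijenhuis X Y Z p : smooth_vfield X -> smooth_vfield Y ->
  smooth_vfield Z ->
  A (JJ X) Y Z p - A (JJ Y) X Z p - A Y (JJ X) Z p + A X (JJ Y) Z p = 0.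
Proof.
move=> sX sY sZ; have sJX := smooth_J sX; have sJY := smooth_J sY.
have BJ U V : smooth_vfield U -> smooth_vfield V ->
    B U (JJ V) p = - (J p (nabla U (JJ V) p)) - nabla U V p.
  move=> sU sV; rewrite B_J// /B kahler_J_additive kahler_JN (kahler_sqr K).
  by rewrite opprK opprD.
have := kahler_integrable K sX sY p; rewrite /nijenhuis -/JJ.
rewrite -!(lc_torsion_free lc)// !kahler_J_additive !kahler_JN.
move=> /(congr1 (g p ^~ (Z p))).
rewrite /A !BJ// /B !gDl !gNl [g p 0 _]gs (form0r gl) !gDl !gNl.
lra.
Qed.

Lemma kahler_parallel X Y p : smooth_vfield X -> smooth_vfield Y ->
  nabla X (JJ Y) p = J p (nabla X Y p).
Proof.
move=> sX sY; apply/eqP; rewrite -subr_eq0 -[_ - _]/(B X Y p).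
(* By positivity of $g$ it is enough to pair $(\nabla_XJ)Y$ with itself; the pairing is then shown
   to vanish with any smooth field [Z]. *)
suff A0 : A X Y (B X Y) p = 0.
  case: (kahler_riemannian K) => _ _ gpos; apply: contraT => /(gpos p).
  by rewrite [ltRHS]A0 ltxx.
move: (B X Y) (smooth_B sX sY) => Z sZ.
have sJX := smooth_J sX; have sJY := smooth_J sY; have sJZ := smooth_J sZ.
(* [c2] and [nij] combine to $A(X,Y,Z)=A(Y,Z,X)-A(Z,Y,X)$, while [c1] gives the same equation with
   the right side negated; so $2A(X,Y,Z)=0$. *)
have c1 := A_cycle p sX sY sZ; have c2 := A_cycle p sX sJY sJZ.
have nij := A_nijenhuis p sY sJZ sX.
have f1 : A X (JJ Y) (JJ Z) p = - A X Y Z p by rewrite A_J// JJE /A gNr.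
have f2 : A (JJ Z) X (JJ Y) p = - A (JJ Z) (JJ Y) X p.
  by rewrite -A_J// A_skew// -A_J.
have f3 : A (JJ (JJ Z)) Y X p = - A Z Y X p by rewrite JJE /A B_Nl// gNl.
have f4 : A Y (JJ (JJ Z)) X p = - A Y Z X p by rewrite JJE /A B_N// gNl.
have f5 := A_skew p sZ sX sY.
lra.
Qed.

End KahlerParallel.

(** * The Levi-Civita connection of $g^L$ on lifts and $\xi$ *)

Section LiftedConnection.
Variables (R : realType) (m : nat) (N : smooth_manifold 'rV[R]_m).
Variables (J : N -> 'rV[R]_m -> 'rV[R]_m).
Variables (g : N -> 'rV[R]_m -> 'rV[R]_m -> R) (tau : N -> 'rV[R]_m -> R).
Let M := line_prod N.
Variables (nabla : vfield N -> vfield N -> vfield N).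
Variables (nablaL : vfield M -> vfield M -> vfield M).
Hypotheses (K : kahler J g) (tau_smooth : smooth_1form tau).
Hypothesis omega_eq : forall X Y : vfield N, smooth_vfield X ->
  smooth_vfield Y -> forall p, kahler_form J g p (X p) (Y p) = ext_d tau X Y p.
Hypotheses (lc : levi_civita g nabla)
  (lcL : levi_civita (M := M) (gL g tau) nablaL).
Implicit Types (X Y Z W : vfield N) (p : M).

Local Notation lift := (lift_vfield tau).
Local Notation xi := (@Defs.xi R 'rV[R]_m N).
Local Notation gL := (Defs.gL g tau : M -> R * 'rV[R]_m -> R * 'rV[R]_m -> R).
Local Notation eta := (Defs.eta tau : M -> R * 'rV[R]_m -> R).
Local Notation JJ := (app_endo J).

Let h X Y : N -> R := fun q => g q (J q (X q)) (Y q).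

Let gl := kahler_linear K.
Let gs := kahler_sym K.

Lemma tau_linear q a u v : tau q (a *: u + v) = a * tau q u + tau q v.
Proof. exact: tau_smooth.1. Qed.

Lemma tauD q u v : tau q (u + v) = tau q u + tau q v.
Proof. by have := tau_linear q 1 u v; rewrite scale1r mul1r. Qed.

Lemma tau0 q : tau q 0 = 0.
Proof. by have := tauD q 0 0; rewrite addr0; lra. Qed.

Lemma tauN q u : tau q (- u) = - tau q u.
Proof. by have := tauD q u (- u); rewrite subrr tau0; lra. Qed.

Lemma gL_linear p u : scalar (gL p u).
Proof.
move=> a v w; rewrite /Defs.gL /Defs.eta /= tau_linear (form_linear gl).
by rewrite -[a *: v.1]/(a * v.1); ring.
Qed.

Lemma gL_sym p u v : gL p u v = gL p v u.
Proof. by rewrite /Defs.gL (gs p.2) mulrC. Qed.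

Lemma eta_lift X p : eta p (lift X p) = 0.
Proof. by rewrite /Defs.eta addNr. Qed.

Lemma eta_xi p : eta p (xi p) = 1.
Proof. by rewrite /Defs.eta /= tau0 addr0. Qed.

Lemma gL_liftr X p v : gL p v (lift X p) = g p.2 v.2 (X p.2).
Proof. by rewrite /Defs.gL eta_lift mulr0 add0r. Qed.

Lemma gL_xir p v : gL p v (xi p) = eta p v.
Proof. by rewrite /Defs.gL eta_xi mulr1 (form0r gl) addr0. Qed.

Lemma smooth_tau X : smooth_vfield X -> smooth_fun (fun q => tau q (X q)).
Proof. exact: smooth_1form_app. Qed.

Lemma smooth_lift X : smooth_vfield X -> smooth_vfield (lift X : vfield M).
Proof.
by move=> sX; exact: (smooth_prod_vfield (smooth_funN (smooth_tau sX)) sX).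
Qed.

Lemma smooth_xi : smooth_vfield (xi : vfield M).
Proof.
exact: (smooth_prod_vfield (smooth_fun_cst (M := N) 1) (@smooth_vfield0 _ _ N)).
Qed.

Lemma smooth_h X Y : smooth_vfield X -> smooth_vfield Y -> smooth_fun (h X Y).
Proof.
move=> sX sY; apply: (@smooth_2tensor_app _ _ _ g (JJ X)) => //.
  by case: (kahler_riemannian K).
exact: smooth_J K _ sX.
Qed.

(** The $\partial_t$ component is $-X(\tau(Y))+Y(\tau(X))=-2\,d\tau(X,Y)-\tau([X,Y])$. The last term
    belongs to $[X,Y]^L$, and the rest is $-2\omega(X,Y)=2h(X,Y)$. *)
Lemma lie_lift X Y : smooth_vfield X -> smooth_vfield Y ->
  lie (lift X : vfield M) (lift Y) =
  fun p => lift (lie X Y) p + (2 * h X Y p.2) *: xi p.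
Proof.
move=> sX sY; apply/funext => p.
have tX := smooth_tau sX; have tY := smooth_tau sY.
rewrite [LHS](lie_prod_vfield p (smooth_funN tX) sX (smooth_funN tY) sY).
rewrite !dirderN//; have := omega_eq sX sY p.2.
rewrite /kahler_form -[g _ _ _]opprK -(kahler_skew K) /ext_d -/(h X Y p.2).
move=> he; congr pair; rewrite /=; last by rewrite scaler0 addr0.
by rewrite [_ *: _]mulr1; lra.
Qed.

Lemma lie_xi_lift X p : smooth_vfield X ->
  lie (xi : vfield M) (lift X) p = 0.
Proof.
move=> sX; have sf : smooth_fun (fun _ : N => 1 : R) by exact: smooth_fun_cst.
rewrite [LHS](lie_prod_vfield p sf (@smooth_vfield0 _ _ N)
  (smooth_funN (smooth_tau sX)) sX).
by rewrite dirder0 dirder_cst subr0 lie0.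
Qed.

Lemma lie_lift_xi X p : smooth_vfield X ->
  lie (lift X : vfield M) xi p = 0.
Proof.
move=> sX; rewrite -(lc_torsion_free lcL (smooth_lift sX) smooth_xi).
rewrite -opprB (lc_torsion_free lcL smooth_xi (smooth_lift sX)).
by rewrite lie_xi_lift ?oppr0.
Qed.

Lemma lie_xi_xi p : lie (xi : vfield M) xi p = 0.
Proof. by rewrite -(lc_torsion_free lcL smooth_xi smooth_xi) subrr. Qed.

Lemma dirder_lift X (f : N -> R) p : smooth_fun f ->
  dirder (lift X : vfield M) (fun q : M => f q.2) p = dirder X f p.2.
Proof. exact: (@dirder_line_prod _ _ N (fun q => - tau q (X q)) X f p). Qed.

Lemma dirder_xi (f : N -> R) p : smooth_fun f ->
  dirder (xi : vfield M) (fun q : M => f q.2) p = 0.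
Proof.
move=> sf.
by rewrite [LHS](@dirder_line_prod _ _ N (fun=> 1) (fun=> 0) f p sf) dirder0.
Qed.

Lemma gL_lift_nondegenerate (U V : vfield M) p :
  smooth_vfield U -> smooth_vfield V ->
  (forall W, smooth_vfield W ->
     gL p (U p) (lift W p) = gL p (V p) (lift W p)) ->
  gL p (U p) (xi p) = gL p (V p) (xi p) -> U p = V p.
Proof.
case: p => t q sU sV UV; rewrite !gL_xir.
(* The test field: the horizontal difference with t frozen at its value at the given point. The test
   against its lift says $g(W,W)=0$ at [q]. *)
pose W : vfield N := fun r => (U (t, r)).2 + - (V (t, r)).2.
have sW : smooth_vfield W.
  apply: smooth_vfieldD; last apply: smooth_vfieldN;
    exact: smooth_vfield_slice.
have gW : g q (W q) (W q) = 0.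
  have := UV _ sW; rewrite !gL_liftr /= => UVW.
  by rewrite {1}/W (formDl gl gs) (formNl gl gs) UVW subrr.
have W0 : W q = 0.
  apply/eqP; case: (kahler_riemannian K) => _ _ gpos.
  by apply: contraT => /(gpos q); rewrite gW ltxx.
have UV2 : (U (t, q)).2 = (V (t, q)).2 by apply/eqP; rewrite -subr_eq0 -W0.
(* The components along $\mathcal N$ agree, so equality of the values of $\eta$ leaves equality of
   the $\partial_t$ components. *)
rewrite /Defs.eta UV2 => /addIr UV1.
by rewrite (surjective_pairing (U _)) (surjective_pairing (V _)) UV1 UV2.
Qed.

Let kL := koszul gL_linear gL_sym lcL.

Lemma gL_lift_xi X : (fun p : M => gL p (lift X p) (xi p)) = fun=> 0.
Proof. by apply/funext => p; rewrite gL_xir eta_lift. Qed.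

Lemma gL_xi_lift X : (fun p : M => gL p (xi p) (lift X p)) = fun=> 0.
Proof. by apply/funext => p; rewrite gL_sym gL_xir eta_lift. Qed.

Lemma gL_xi_xi : (fun p : M => gL p (xi p) (xi p)) = fun=> 1.
Proof. by apply/funext => p; rewrite gL_xir eta_xi. Qed.

Lemma smooth_g X Y : smooth_vfield X -> smooth_vfield Y ->
  smooth_fun (fun q => g q (X q) (Y q)).
Proof.
move=> sX sY; apply: smooth_2tensor_app => //.
by case: (kahler_riemannian K).
Qed.

Lemma dirder_lift_gL X Y Z p : smooth_vfield Y -> smooth_vfield Z ->
  dirder (lift X : vfield M) (fun q => gL q (lift Y q) (lift Z q)) p =
  dirder X (fun q => g q (Y q) (Z q)) p.2.
Proof.
move=> sY sZ; rewrite -(dirder_lift _ _ (smooth_g sY sZ)).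
by congr dirder; apply/funext => q; rewrite gL_liftr.
Qed.

Lemma dirder_xi_gL Y Z p : smooth_vfield Y -> smooth_vfield Z ->
  dirder (xi : vfield M) (fun q => gL q (lift Y q) (lift Z q)) p = 0.
Proof.
move=> sY sZ; rewrite -[RHS](dirder_xi p (smooth_g sY sZ)).
by congr dirder; apply/funext => q; rewrite gL_liftr.
Qed.

Lemma gL_lie_lift X Y p v : smooth_vfield X -> smooth_vfield Y ->
  gL p (lie (lift X : vfield M) (lift Y) p) v =
  gL p (lift (lie X Y) p) v + 2 * h X Y p.2 * eta p v.
Proof.
move=> sX sY; rewrite lie_lift// (formDl gL_linear gL_sym).
by rewrite (gL_sym _ (_ *: _)) (formZr gL_linear) gL_xir.
Qed.

Lemma nablaL_lift_lift X Y : smooth_vfield X -> smooth_vfield Y ->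
  nablaL (lift X) (lift Y) =
  fun p => lift (nabla X Y) p + h X Y p.2 *: xi p.
Proof.
move=> sX sY; apply/funext => p.
have sD : smooth_vfield (nabla X Y) by exact: (conn_smooth (lc_connection lc)).
have LX := smooth_lift sX; have LY := smooth_lift sY.
apply: (@gL_lift_nondegenerate (nablaL (lift X) (lift Y))
  (fun p => lift (nabla X Y) p + h X Y p.2 *: xi p)).
- exact: (conn_smooth (lc_connection lcL)).
- apply: smooth_vfieldD; first exact: smooth_lift.
  apply: smooth_vfieldZ; last exact: smooth_xi.
  by apply: smooth_fun_line_prod; exact: smooth_h.
(* The $\xi$ parts of the brackets are orthogonal to lifts, so the Koszul formula for $g^L$ reduces
   to that for $g$. *)
- move=> W sW; have LW := smooth_lift sW.
  rewrite (formDl gL_linear gL_sym) (gL_sym _ (_ *: _)) (formZr gL_linear).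
  rewrite gL_xir eta_lift mulr0 addr0.
  have := kL LX LY LW p; rewrite !dirder_lift_gL//.
  rewrite [X in _ + X - _ - _](gL_lie_lift p (lift W p) sX sY).
  rewrite [X in _ - X - _](gL_lie_lift p (lift Y p) sX sW).
  rewrite [X in _ - X](gL_lie_lift p (lift X p) sY sW) !eta_lift !mulr0 !addr0.
  rewrite [gL p (lift (nabla X Y) p) _]gL_liftr.
  rewrite [X in _ + X - _ - _]gL_liftr [X in _ - X - _]gL_liftr.
  rewrite [X in _ - X]gL_liftr.
  by have := koszul gl gs lc sX sY sW p.2 => /=; lra.
(* Against $\xi$ only $g^L([X^L,Y^L],\xi)=2h(X,Y)$ survives in the Koszul formula. *)
- rewrite (formDl gL_linear gL_sym) (gL_sym _ (_ *: _)) (formZr gL_linear).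
  rewrite !gL_xir eta_lift eta_xi mulr1 add0r.
  have := kL LX LY smooth_xi p.
  rewrite !gL_lift_xi !dirder_cst dirder_xi_gL//.
  rewrite !lie_lift_xi// !(gL_sym p 0) !(form0r gL_linear).
  rewrite (gL_lie_lift p (xi p) sX sY).
  by rewrite !gL_xir eta_lift eta_xi; lra.
Qed.

Lemma nablaL_lift_xi X p : smooth_vfield X ->
  nablaL (lift X) xi p = - lift (JJ X) p.
Proof.
move=> sX; have LX := smooth_lift sX; have sJ := smooth_J K sX.
apply: (@gL_lift_nondegenerate (nablaL (lift X) xi) (fun p => - lift (JJ X) p)).
- by apply: (conn_smooth (lc_connection lcL)) => //; exact: smooth_xi.
- by apply: smooth_vfieldN; exact: smooth_lift.
(* Here the only surviving Koszul term is $-g^L([X^L,W^L],\xi)=-2h(X,W)$. *)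
- move=> W sW; have LW := smooth_lift sW; rewrite (formNl gL_linear gL_sym).
  rewrite [X in _ = - X]gL_liftr -[X in _ = - X]/(h X W p.2).
  have := kL LX smooth_xi LW p.
  rewrite gL_xi_lift gL_lift_xi !dirder_cst dirder_xi_gL//.
  rewrite lie_lift_xi// lie_xi_lift// !(gL_sym p 0) !(form0r gL_linear).
  rewrite (gL_lie_lift p (xi p) sX sW) eta_xi gL_xir eta_lift.
  by lra.
- rewrite (formNl gL_linear gL_sym) (gL_xir p (lift _ _)) eta_lift oppr0.
  have := kL LX smooth_xi smooth_xi p.
  rewrite gL_xi_xi gL_lift_xi !dirder_cst lie_lift_xi// lie_xi_xi.
  by rewrite !(gL_sym p 0) !(form0r gL_linear); lra.
Qed.

Lemma nablaL_xi_lift X p : smooth_vfield X ->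
  nablaL xi (lift X) p = - lift (JJ X) p.
Proof.
move=> sX; apply/eqP; rewrite -(nablaL_lift_xi _ sX) -subr_eq0.
rewrite (lc_torsion_free lcL smooth_xi (smooth_lift sX)).
by rewrite lie_xi_lift.
Qed.

(** This is $\nabla\omega=0$, and the point where $\nabla J=0$ enters the curvature computation. *)
Lemma dirder_h X Y Z q : smooth_vfield X -> smooth_vfield Y ->
  smooth_vfield Z ->
  dirder X (h Y Z) q = h (nabla X Y) Z q + h Y (nabla X Z) q.
Proof.
move=> sX sY sZ; have := lc_metric lc sX (smooth_J K sY) sZ q.
by rewrite (kahler_parallel K lc).
Qed.

(** In the coefficient of $\xi$, the first term comes from differentiating the lift $(\nabla_YZ)^L$
    and the other two from differentiating the function $h(Y,Z)$. The last summand is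
    $h(Y,Z)D_{X^L}\xi$. *)
Lemma nablaL_nablaL X Y Z p : smooth_vfield X -> smooth_vfield Y ->
  smooth_vfield Z ->
  nablaL (lift X) (nablaL (lift Y) (lift Z)) p =
    lift (nabla X (nabla Y Z)) p +
    (h X (nabla Y Z) p.2 + h (nabla X Y) Z p.2 + h Y (nabla X Z) p.2) *: xi p
    - h Y Z p.2 *: lift (JJ X) p.
Proof.
move=> sX sY sZ; rewrite nablaL_lift_lift//.
have sYZ : smooth_vfield (nabla Y Z) by exact: (conn_smooth (lc_connection lc)).
have sh : smooth_fun (fun q : M => h Y Z q.2).
  by apply: smooth_fun_line_prod; exact: smooth_h.
have sx := smooth_xi.
rewrite (connDr (lc_connection lcL) (smooth_lift sX) (smooth_lift sYZ)
  (smooth_vfieldZ sh sx)).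
rewrite (connZr (lc_connection lcL) sh (smooth_lift sX) sx).
rewrite nablaL_lift_lift// nablaL_lift_xi// dirder_lift; last exact: smooth_h.
by rewrite dirder_h// scalerN addrA -(addrA (lift _ _)) -scalerDl addrA.
Qed.

(** The vertical part $2h(X,Y)\xi$ of the bracket is the source of the coefficient 2 in the
    curvature formula. *)
Lemma nablaL_lie X Y Z p : smooth_vfield X -> smooth_vfield Y ->
  smooth_vfield Z ->
  nablaL (lie (lift X : vfield M) (lift Y)) (lift Z) p =
    lift (nabla (lie X Y) Z) p + h (lie X Y) Z p.2 *: xi p
    - (2 * h X Y p.2) *: lift (JJ Z) p.
Proof.
move=> sX sY sZ; have sXY := smooth_lie lc sX sY.
have sh : smooth_fun (fun q : M => 2 * h X Y q.2).
  apply: smooth_funM; first exact: smooth_fun_cst.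
  by apply: smooth_fun_line_prod; exact: smooth_h.
have sx := smooth_xi; have LZ := smooth_lift sZ; rewrite lie_lift//.
rewrite (connDl (lc_connection lcL) (smooth_lift sXY)
  (smooth_vfieldZ sh sx) LZ).
rewrite (connZl (lc_connection lcL) sh sx LZ).
by rewrite nablaL_lift_lift// nablaL_xi_lift// scalerN.
Qed.

End LiftedConnection.

(** * Assembly of the curvature *)

Lemma curvature_sum (R : realType) m (L1 L2 L3 P Q S x : R * 'rV[R]_m)
    (a b c s t : R) :
  (L1 + s *: x - a *: P) - (L2 + t *: x - b *: Q)
    - (L3 + (s - t) *: x - (2 * c) *: S) =
  L1 - L2 - L3 + - a *: P - - b *: Q - (2 * - c) *: S.
Proof.
rewrite scalerBl mulrN !scaleNr.
move: (s *: x) (t *: x) (a *: P) (b *: Q) (_ *: S) => s' t' a' b' c'.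
apply: injective_projections => /=; first by ring.
by apply/rowP => j; rewrite !mxE; ring.
Qed.

Theorem proposition4 (R : realType) (n : nat)
    (N : smooth_manifold 'rV[R]_(2 * n))
    (J : N -> 'rV[R]_(2 * n) -> 'rV[R]_(2 * n))
    (g : N -> 'rV[R]_(2 * n) -> 'rV[R]_(2 * n) -> R)
    (tau : N -> 'rV[R]_(2 * n) -> R)
    (nabla : vfield N -> vfield N -> vfield N)
    (nablaL : vfield (line_prod N) -> vfield (line_prod N) ->
              vfield (line_prod N))
    (N_kahler : kahler J g)
    (tau_smooth : smooth_1form tau)
    (omega_eq : forall X Y : vfield N, smooth_vfield X -> smooth_vfield Y ->
       forall p, kahler_form J g p (X p) (Y p) = ext_d tau X Y p)
    (nabla_lc : levi_civita g nabla)
    (nablaL_lc : levi_civita (M := line_prod N) (gL g tau) nablaL)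
    (X Y Z : vfield N)
    (X_smooth : smooth_vfield X) (Y_smooth : smooth_vfield Y)
    (Z_smooth : smooth_vfield Z) (p : line_prod N) :
  let XL := lift_vfield tau X in
  let YL := lift_vfield tau Y in
  let ZL := lift_vfield tau Z in
  let phi := phi J tau in
  let Phi := Phi J g tau in
  curvature nablaL XL YL ZL p =
    lift_vfield tau (curvature nabla X Y Z) p
    + Phi YL ZL p *: phi p (XL p)
    - Phi XL ZL p *: phi p (YL p)
    - (2 * Phi XL YL p) *: phi p (ZL p).
Proof.
move=> XL YL ZL phi Phi.
pose h (U V : vfield N) (q : N) := g q (J q (U q)) (V q).
have PhiE (U V : vfield N) :
    Phi (lift_vfield tau U) (lift_vfield tau V) p = - h U V p.2.
  rewrite [LHS](gL_liftr g tau (app_endo J V)).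
  by rewrite /h (kahler_skew N_kahler) opprK.
have hlie : h (lie X Y) Z p.2 = h (nabla X Y) Z p.2 - h (nabla Y X) Z p.2.
  rewrite /h -(lc_torsion_free nabla_lc X_smooth Y_smooth).
  rewrite (kahler_J_additive N_kahler) (kahler_JN N_kahler).
  rewrite (formDl (kahler_linear N_kahler) (kahler_sym N_kahler)).
  by rewrite (formNl (kahler_linear N_kahler) (kahler_sym N_kahler)).
have liftE : lift_vfield tau (curvature nabla X Y Z) p =
    lift_vfield tau (nabla X (nabla Y Z)) p
    - lift_vfield tau (nabla Y (nabla X Z)) p
    - lift_vfield tau (nabla (lie X Y) Z) p.
  congr pair; rewrite /= /curvature !(tauD tau_smooth) !(tauN tau_smooth).
  by ring.
rewrite !PhiE liftE /curvature.
rewrite (nablaL_nablaL N_kahler tau_smooth omega_eq nabla_lc nablaL_lc)//.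
rewrite (nablaL_nablaL N_kahler tau_smooth omega_eq nabla_lc nablaL_lc)//.
rewrite (nablaL_lie N_kahler tau_smooth omega_eq nabla_lc nablaL_lc)//.
(* The coefficient of $\xi$ in $D_{U^L}D_{V^L}Z^L$. Its first and last terms together are symmetric
   in [U] and [V], so antisymmetrizing leaves $h([X,Y],Z)$, the coefficient in the bracket term, and
   $\xi$ drops out. *)
pose s U V := h U (nabla V Z) p.2 + h (nabla U V) Z p.2 + h V (nabla U Z) p.2.
have st : h (lie X Y) Z p.2 = s X Y - s Y X by rewrite hlie /s; ring.
rewrite -(curvature_sum _ _ _ _ _ _ (xi p) (h Y Z p.2) (h X Z p.2) (h X Y p.2)
  (s X Y) (s Y X)) -st.
(* $\phi X^L$ and $(JX)^L$ are convertible. *)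
reflexivity.
Qed.
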